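(* Let $(C,X,F,Y)$ be random elements of standard Borel spaces such that $F-(X,C)-Y$ is a Markov chain. Let $\mathcal Q\subseteq\mathcal P(\mathcal F)$ be a class of admissible predictive reports, and let the measurable loss $L:\mathcal Q\times\mathcal F\to\overline{\mathbb R}$ be proper on $\mathcal Q$. Assume that $S_X,S_Y\in\mathcal Q$ almost surely, and suppose that all expectations and risk differences displayed below are well defined. Then $$\mathbb E[D_L(S_X\|S_Y)]=H_L(F\mid Y,C)-H_L(F\mid X,C)\ge 0.$$ If $L$ is strictly proper on $\mathcal Q$, the common value is zero if and only if $S_X=S_Y$ almost surely, or equivalently, if and only if $F\perp\!\!\!\perp X\mid (Y,C)$.
   Context: All random elements take values in standard Borel spaces; $\mathcal P(\mathcal F)$ is the space of probability measures on $\mathcal F$ with its evaluation $\sigma$-field, and $\mathcal Q$ carries the trace $\sigma$-field. Measurable versions of conditional distributions are fixed, and identities between kernels hold almost surely. For an information variable $U$ jointly distributed with $(F,C)$, $S_U\triangleq P_{F\mid U,C}(\,\cdot\mid U,C)$ is the conditional law of $F$ given $(U,C)$; thus $S_X=P_{F\mid X,C}(\cdot\mid X,C)$ and $S_Y=P_{F\mid Y,C}(\cdot\mid Y,C)$. For $P,Q\in\mathcal Q$: $R_L(P,Q)\triangleq\mathbb E_{F\sim P}[L(Q,F)]$. $L$ is *proper* on $\mathcal Q$ if $R_L(P,P)\le R_L(P,Q)$ for all $P,Q\in\mathcal Q$, and *strictly proper* if moreover equality holds only when $Q=P$. The Bayes risk is $H_L(P)\triangleq R_L(P,P)$, and, whenever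 the difference is well defined, the loss-induced divergence is $D_L(P\|Q)\triangleq R_L(P,Q)-R_L(P,P)$. For $U$ with $S_U\in\mathcal Q$ almost surely, the conditional Bayes risk is $H_L(F\mid U,C)\triangleq\mathbb E[H_L(S_U)]$. $F-(X,C)-Y$ means that $F$ and $Y$ are conditionally independent given $(X,C)$. *)

(* Defs.v *)
From HB Require Import structures.
From mathcomp Require Export all_boot all_order all_algebra.
From mathcomp Require Export all_classical all_reals all_analysis.
From mathcomp Require Export measurable_realfun.
Export numFieldNormedType.Exports.

Set Implicit Arguments.
Unset Strict Implicit.
Unset Printing Implicit Defensive.

Local Open Scope classical_set_scope.
Local Open Scope ring_scope.
Local Open Scope ereal_scope.

(* Borel isomorphic to a Polish space: a complete Hausdorff pseudometric space
   is a complete metric space, for which separability is second countability. *)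
Definition standard_borel (R : realType) d (T : measurableType d) : Prop :=
  exists (E : completePseudoMetricType R) (f : T -> E),
    [/\ hausdorff_space E, @second_countable E, bijective f &
        forall B : set E, measurable (f @^-1` B) <-> <<s @open E >> B].

(* Leibniz equality on [probability T R] also compares the values taken by the
   underlying set functions outside the sigma-algebra, so equality of
   probability measures is agreement on measurable sets. *)
Definition same_law (R : realType) d (T : measurableType d)
    (p q : pprobability T R) : Prop :=
  forall A : set T, measurable A -> p A = q A.

(* The two halves of the integral of f are not both infinite. *)
Definition integral_defined (R : realType) d (T : measurableType d)
    (mu : {measure set T -> \bar R}) (f : T -> \bar R) : Prop :=
  (\int[mu]_x f^\+ x) +? - (\int[mu]_x f^\- x).

Section conditioning.
Context (R : realType) d (Omega : measurableType d) (P : probability Omega R).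

Definition rv_pair U W (X : Omega -> U) (Y : Omega -> W) (w : Omega) : U * W :=
  (X w, Y w).

Definition is_cond_law dV dF (TV : measurableType dV) (TF : measurableType dF)
    (F : Omega -> TF) (V : Omega -> TV) (k : TV -> pprobability TF R) : Prop :=
  measurable_fun setT k /\
  forall (A : set TF) (B : set TV), measurable A -> measurable B ->
    P (F @^-1` A `&` V @^-1` B) = \int[P]_(w in V @^-1` B) k (V w) A.

(* p (V w) is a version of the conditional probability of E given V. *)
Definition is_cond_prob dV (TV : measurableType dV)
    (E : set Omega) (V : Omega -> TV) (p : TV -> R) : Prop :=
  [/\ measurable_fun setT p,
      P.-integrable setT (fun w => (p (V w))%:E) &
      forall B : set TV, measurable B ->
        P (E `&` V @^-1` B) = \int[P]_(w in V @^-1` B) (p (V w))%:E].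

(* Versions always exist and are almost surely unique, so that existence of
   versions satisfying the product rule amounts to the rule for all versions. *)
Definition cond_indep dF dY dV (TF : measurableType dF) (TY : measurableType dY)
    (TV : measurableType dV)
    (F : Omega -> TF) (Y : Omega -> TY) (V : Omega -> TV) : Prop :=
  forall (A : set TF) (B : set TY), measurable A -> measurable B ->
    exists p q : TV -> R,
      [/\ is_cond_prob (F @^-1` A) V p, is_cond_prob (Y @^-1` B) V q &
          is_cond_prob (F @^-1` A `&` Y @^-1` B) V (fun v => (p v * q v)%R)].

End conditioning.

Section losses.
Context (R : realType) d (T : measurableType d).

(* A loss on Q x T is encoded by a total function whose values outside Q are
   irrelevant.  As Q need not be measurable, measurability is with respect to
   the trace on Q x T of the product sigma-algebra; [measurable_fun] on
   [Q `*` setT] would hold trivially for nonmeasurable Q. *)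
Definition measurable_loss (Q : set (pprobability T R))
    (L : pprobability T R -> T -> \bar R) : Prop :=
  forall B : set (\bar R), measurable B ->
    exists2 A : set (pprobability T R * T), measurable A &
      [set z | Q z.1 /\ B (L z.1 z.2)] = [set z | Q z.1 /\ A z].

Variable L : pprobability T R -> T -> \bar R.

Definition risk (p q : pprobability T R) : \bar R := \int[p]_x L q x.

Definition risk_defined (p q : pprobability T R) : Prop :=
  integral_defined p (L q).

Definition bayes_risk (p : pprobability T R) : \bar R := risk p p.

Definition divergence (p q : pprobability T R) : \bar R :=
  risk p q - risk p p.

Definition divergence_defined (p q : pprobability T R) : Prop :=
  [/\ risk_defined p q, risk_defined p p & risk p q +? - risk p p].

(* Risks are compared only where the expectations exist. *)
Definition proper (Q : set (pprobability T R)) : Prop :=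
  forall p q, Q p -> Q q -> risk_defined p p -> risk_defined p q ->
    risk p p <= risk p q.

Definition strictly_proper (Q : set (pprobability T R)) : Prop :=
  proper Q /\
  forall p q, Q p -> Q q -> risk_defined p p -> risk_defined p q ->
    risk p p = risk p q -> same_law q p.

Context d' (Omega : measurableType d') (P : probability Omega R).

Definition cond_bayes_risk (S : Omega -> pprobability T R) : \bar R :=
  \int[P]_w bayes_risk (S w).

Definition cond_bayes_risk_defined (S : Omega -> pprobability T R) : Prop :=
  {ae P, forall w, risk_defined (S w) (S w)} /\
  integral_defined P (fun w => bayes_risk (S w)).

Definition expected_divergence (S S' : Omega -> pprobability T R) : \bar R :=
  \int[P]_w divergence (S w) (S' w).

Definition expected_divergence_defined (S S' : Omega -> pprobability T R) :
    Prop :=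
  {ae P, forall w, divergence_defined (S w) (S' w)} /\
  integral_defined P (fun w => divergence (S w) (S' w)).

End losses.

(* Main.v *)
(** A proper loss makes [D_L(S_X||S_Y) = R_L(S_X, S_Y) - H_L(S_X)] nonnegative,
    so everything rests on the tower property E R_L(S_X, S_Y) = E H_L(S_Y).  By
    the Markov chain, S_X is also the conditional law of F given (Y, X, C), and
    therefore S_X and S_Y integrate every nonnegative function of (Y, C, F) to
    the same value.  Since L(S_Y, F) need not have a well-defined expectation,
    the positive and negative parts are compared on the countably many events of
    sigma(Y, C) on which the conditional expectation of one of them is bounded.
    When E H_L(S_X) = -oo, E D_L < +oo would force E H_L(S_Y) = -oo.  In the
    strict case both S_X and S_Y are conditional laws of F given (X, Y, C) if and
    only if F and X are independent given (Y, C); almost sure equality of laws is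
    tested on a countable determining class, given by the standard Borel
    structure.  As Q need not be measurable, L is first replaced by a measurable
    function on the whole product that agrees with it on Q. *)

From HB Require Import structures.
Require Import Defs.

From mathcomp Require Import lra.

Set Implicit Arguments.
Unset Strict Implicit.
Unset Printing Implicit Defensive.

Import Order.TTheory GRing.Theory Num.Theory.

Local Open Scope classical_set_scope.
Local Open Scope ring_scope.
Local Open Scope ereal_scope.

(** * Comparison of integrals of functions that need not be measurable *)

Section integral_ae.
Context d (T : measurableType d) (R : realType) (mu : {measure set T -> \bar R}).
Import HBNNSimple.

(** A simple function below [f] keeps its integral when it is set to 0 on the exceptional null set,
    and it is then below [g]. Measurability is not assumed because risks and divergences are tied to
    measurable functions only almost everywhere. *)
Lemma ge0_integral_ae_le (f g : T -> \bar R) :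
  (forall x, 0 <= f x) -> (forall x, 0 <= g x) ->
  {ae mu, forall x, f x <= g x} -> \int[mu]_x f x <= \int[mu]_x g x.
Proof.
move=> f0 g0 [N [mN N0 fgN]].
rewrite ge0_integralTE// [leRHS]ge0_integralTE//.
apply: ge_ereal_sup => _ [h /= hf <-].
have mNc : measurable (~` N) by exact: measurableC.
pose k : {nnsfun T >-> R} := mul_nnsfun h (indic_nnsfun R mNc).
have -> : sintegral mu h = sintegral mu k.
  rewrite -!integralT_nnsfun; apply: ge0_ae_eq_integral => //.
  - exact/measurable_EFinP.
  - exact/measurable_EFinP.
  - by move=> x _; rewrite lee_fin.
  - by move=> x _; rewrite lee_fin.
  - exists N; split => // x /=; apply: contra_notP => Nx _.
    by rewrite /= /mindic indicE mem_set ?mulr1.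
apply: ereal_sup_ubound; exists k => //= x.
rewrite /mindic indicE; case: (pselect (N x)) => Nx.
  by rewrite memNset ?mulr0//; exact.
rewrite mem_set// mulr1 (le_trans (hf x))//.
by apply: contrapT => fg; apply: Nx; exact: fgN.
Qed.

Lemma ge0_integral_ae_eq (f g : T -> \bar R) :
  (forall x, 0 <= f x) -> (forall x, 0 <= g x) ->
  {ae mu, forall x, f x = g x} -> \int[mu]_x f x = \int[mu]_x g x.
Proof.
move=> f0 g0 fg; apply/eqP; rewrite eq_le; apply/andP; split;
  by apply: ge0_integral_ae_le => //; apply: filterS fg => x ->.
Qed.

Lemma integral_ae_congr (f g : T -> \bar R) :
  {ae mu, forall x, f x = g x} -> \int[mu]_x f x = \int[mu]_x g x.
Proof.
move=> fg; rewrite integralE [RHS]integralE; congr (_ - _);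
  by apply: ge0_integral_ae_eq => //; apply: filterS fg => x fgx;
     rewrite ?funeposE ?funenegE fgx.
Qed.

Lemma integral_defined_ae (f g : T -> \bar R) :
  {ae mu, forall x, f x = g x} -> integral_defined mu f -> integral_defined mu g.
Proof.
move=> fg; rewrite /integral_defined.
rewrite (@ge0_integral_ae_eq f^\+ g^\+)//; last first.
  by apply: filterS fg => x fgx; rewrite !funeposE fgx.
rewrite (@ge0_integral_ae_eq f^\- g^\-)//.
by apply: filterS fg => x fgx; rewrite !funenegE fgx.
Qed.

End integral_ae.

(** * Monotone class argument for nonnegative measurable functions *)

Section monotone_class.
Context d (T : measurableType d) (R : realType).
Import HBNNSimple.

(** The simple approximations of [f] increase to it pointwise, and each is a finite sum of
    nonnegative constants times indicators. *)
Lemma ge0_measurable_fun_ind (H : (T -> \bar R) -> Prop) :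
  (forall A, measurable A -> H (EFin \o \1_A)) ->
  (forall (c : R) f, (0 <= c)%R -> measurable_fun setT f ->
     (forall x, 0 <= f x) -> H f -> H (fun x => c%:E * f x)) ->
  (forall f g, measurable_fun setT f -> measurable_fun setT g ->
     (forall x, 0 <= f x) -> (forall x, 0 <= g x) ->
     H f -> H g -> H (f \+ g)) ->
  (forall f_ : (T -> \bar R)^nat, (forall n, measurable_fun setT (f_ n)) ->
     (forall n x, 0 <= f_ n x) ->
     (forall x, {homo f_ ^~ x : m n / (m <= n)%N >-> m <= n}) ->
     (forall n, H (f_ n)) -> H (fun x => limn (f_ ^~ x))) ->
  forall f, measurable_fun setT f -> (forall x, 0 <= f x) -> H f.
Proof.
move=> Hi Hc Ha Hl f mf f0.
pose f_ := nnsfun_approx measurableT mf.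
have -> : f = fun x => limn (fun n => (f_ n x)%:E).
  by apply/funext => x; apply/esym/cvg_lim => //; exact: cvg_nnsfun_approx.
apply: (Hl (fun n x => (f_ n x)%:E)).
- by move=> n; exact/measurable_EFinP.
- by move=> n x; rewrite lee_fin.
- by move=> x m n mn; rewrite lee_fin; exact/lefP/nd_nnsfun_approx.
move=> n; move: (f_ n) => {f_} h.
have H0 : H (fun=> 0).
  rewrite (_ : (fun=> 0) = EFin \o \1_set0); first exact: Hi.
  by apply/funext => x; rewrite /= indic0.
have [s [ys ->]] : exists s : seq R, (forall y, y \in s -> (0 <= y)%R) /\
    (fun x => (h x)%:E) =
    (fun x => \sum_(y <- s) (y * \1_(h @^-1` [set y]) x)%:E).
  exists (finmap.enum_fset (fset_set (range h))); split.
    by move=> y; rewrite in_fset_set// inE => -[x _ <-].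
  by apply/funext => x; rewrite fimfunE -fsumEFin// fsbig_finite.
(* Closure of [H] under sums asks for measurable nonnegative summands, so the induction on the list
   carries these two facts along. *)
pose good (g : T -> \bar R) :=
  [/\ measurable_fun setT g, forall x, 0 <= g x & H g].
suff : good (fun x => \sum_(y <- s) (y * \1_(h @^-1` [set y]) x)%:E) by case.
elim: s ys => [_|y s IH ys] /=.
  rewrite (_ : (fun x => _) = fun=> 0); first by split.
  by apply/funext => x; rewrite big_nil.
rewrite (_ : (fun x => _) = (fun x => y%:E * (EFin \o \1_(h @^-1` [set y])) x) \+
   (fun x => \sum_(z <- s) (z * \1_(h @^-1` [set z]) x)%:E)); last first.
  by apply/funext => x; rewrite big_cons EFinM.
have [] := IH _.
  by move=> z zs; apply: ys; rewrite in_cons zs orbT.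
move=> mg g0 Hg.
have y0 : (0 <= y)%R by apply: ys; rewrite mem_head.
pose i : T -> \bar R := EFin \o \1_(h @^-1` [set y]).
have mi : measurable_fun setT i.
  by apply/measurable_EFinP; exact: measurable_indic.
have my : measurable_fun setT (fun x => y%:E * i x).
  exact: measurable_funeM.
have i0 x : 0 <= y%:E * i x.
  by rewrite mule_ge0 ?lee_fin.
split; first exact: emeasurable_funD.
- by move=> x; rewrite adde_ge0.
- by apply: Ha => //; apply: Hc => //; [move=> x; rewrite /= lee_fin|exact: Hi].
Qed.

End monotone_class.

(** * Random weights that are functions of [V] *)

Section weights.
Context d dV (T : measurableType d) (TV : measurableType dV) (R : realType)
  (mu : {measure set T -> \bar R}) (V : T -> TV).

Lemma integral_indic_comp (g : T -> \bar R) (B : set TV) :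
  \int[mu]_x ((\1_B (V x))%:E * g x) = \int[mu]_(x in V @^-1` B) g x.
Proof.
rewrite [RHS]integral_mkcond; apply: eq_integral => x _.
rewrite patchE indicE; case: (boolP (V x \in B)) => VB.
  by rewrite mul1e mem_set//; rewrite inE in VB.
by rewrite mul0e memNset//= => /mem_set; rewrite (negbTE VB).
Qed.

(** Monotone class argument in [phi], with the hypothesis as the case of indicators. Finite values
    of [g1] and [g2] let multiplication commute with increasing limits of weights. *)
Lemma ge0_integral_weight (g1 g2 : T -> \bar R) (phi : TV -> \bar R) :
  measurable_fun setT V ->
  measurable_fun setT g1 -> measurable_fun setT g2 ->
  (forall x, 0 <= g1 x) -> (forall x, 0 <= g2 x) ->
  (forall x, g1 x \is a fin_num) -> (forall x, g2 x \is a fin_num) ->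
  (forall B, measurable B ->
    \int[mu]_(x in V @^-1` B) g1 x = \int[mu]_(x in V @^-1` B) g2 x) ->
  measurable_fun setT phi -> (forall v, 0 <= phi v) ->
  \int[mu]_x (phi (V x) * g1 x) = \int[mu]_x (phi (V x) * g2 x).
Proof.
move=> mV mg1 mg2 g10 g20 fg1 fg2 g12 mphi phi0.
have mM (f : TV -> \bar R) (g : T -> \bar R) : measurable_fun setT f ->
    measurable_fun setT g -> measurable_fun setT (fun x => f (V x) * g x).
  by move=> mf mg; apply: emeasurable_funM => //; exact: (measurableT_comp mf).
move: phi mphi phi0; apply: ge0_measurable_fun_ind => /=.
- by move=> A mA; rewrite !integral_indic_comp g12.
- move=> c f c0 mf f0 IH.
  under eq_integral do rewrite -muleA.
  under [RHS]eq_integral do rewrite -muleA.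
  by rewrite !ge0_integralZl// ?IH//; try exact: mM; move=> x _; rewrite mule_ge0.
- move=> f g mf mg f0 g0 IHf IHg.
  under eq_integral do rewrite ge0_muleDl//.
  under [RHS]eq_integral do rewrite ge0_muleDl//.
  by rewrite !ge0_integralD// ?IHf ?IHg//; try exact: mM; move=> x _; rewrite mule_ge0.
move=> f mf f0 ndf IH.
have limM (g : T -> \bar R) : (forall x, g x \is a fin_num) ->
    (forall x, 0 <= g x) -> measurable_fun setT g ->
    \int[mu]_x (limn (f ^~ (V x)) * g x) = limn (fun n => \int[mu]_x (f n (V x) * g x)).
  move=> fg g0 mg; rewrite -monotone_convergence//.
  - apply: eq_integral => x _; rewrite -limeMr//.
    by apply: ereal_nondecreasing_is_cvgn => m n mn; exact: ndf.
  - by move=> n; exact: mM.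
  - by move=> n x _; rewrite mule_ge0.
  - by move=> x _ m n mn; rewrite lee_wpmul2r// ndf.
by rewrite !limM//; congr (limn _); apply/funext => n.
Qed.

End weights.

(** * Measurability of kernels and disintegration *)

Lemma measurable_law_eval d dV (T : measurableType d) (TV : measurableType dV)
    (R : realType) (k : TV -> pprobability T R) (A : set T) :
  measurable_fun setT k -> measurable A -> measurable_fun setT (fun v => k v A).
Proof. by move=> mk mA; exact: (measurable_kernel (kprobability mk)). Qed.

Lemma measurable_law_integral d dV (T : measurableType d) (TV : measurableType dV)
    (R : realType) (k : TV -> pprobability T R) (G : TV * T -> \bar R) :
  measurable_fun setT k -> measurable_fun setT G -> (forall z, 0 <= G z) ->
  measurable_fun setT (fun v => \int[k v]_x G (v, x)).
Proof.
move=> mk mG G0.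
exact: (measurable_fun_integral_finite_kernel G (kprobability mk)).
Qed.

Section disintegration.
Context (R : realType) d (Omega : measurableType d) (P : probability Omega R)
  dV dF (TV : measurableType dV) (TF : measurableType dF)
  (F : Omega -> TF) (V : Omega -> TV) (k : TV -> pprobability TF R).
Hypotheses (mF : measurable_fun setT F) (mV : measurable_fun setT V)
  (hk : is_cond_law P F V k).

Let mVF : measurable_fun setT (fun w => (V w, F w)).
Proof. exact: measurable_fun_pair. Qed.

Let mk : measurable_fun setT k.
Proof. by case: hk. Qed.

Let mxs (A : set (TV * TF)) : measurable A ->
  measurable_fun setT (fun w => k (V w) (xsection A (V w))).
Proof.
move=> mA.
have m1 : measurable_fun setT (EFin \o \1_A : TV * TF -> \bar R).
  by apply/measurable_EFinP; exact: measurable_indic.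
have m2 : measurable_fun setT (fun v => \int[k v]_x (EFin \o \1_A) (v, x)).
  by apply: measurable_law_integral => // z; rewrite lee_fin.
have := kfcompkindic (fun v => k v : {measure set TF -> \bar R}) mA.
rewrite /kfcomp => /funeqP kA.
rewrite (_ : (fun w => _) =
    (fun v => \int[k v]_x (EFin \o \1_A) (v, x)) \o V); last first.
  by apply/funext => w /=; rewrite -kA.
exact: (measurableT_comp m2).
Qed.

(** Dynkin's argument: on rectangles this is the defining property of the kernel, and both sides
    respect complements and countable disjoint unions. *)
Let cond_law_xsection (A : set (TV * TF)) : measurable A ->
  \int[P]_w k (V w) (xsection A (V w)) = P ((fun w => (V w, F w)) @^-1` A).
Proof.
have mpre B : measurable B -> measurable ((fun w => (V w, F w)) @^-1` B).
  by move=> mB; rewrite -[X in measurable X]setTI; exact: mVF.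
pose ok (B : set (TV * TF)) := \int[P]_w k (V w) (xsection B (V w)) =
  P ((fun w => (V w, F w)) @^-1` B).
rewrite measurable_prod_measurableType; apply: (@dynkin_induction _ _ _ ok).
- exact: measurable_prod_measurableType.
- move=> _ _ [A1 mA1 [A2 mA2 <-]] [B1 mB1 [B2 mB2 <-]].
  exists (A1 `&` B1); first exact: measurableI.
  by exists (A2 `&` B2); [exact: measurableI|rewrite setXI].
- rewrite /ok preimage_setT.
  under eq_integral do rewrite xsectionE preimage_setT probability_setT.
  by rewrite integral_cst// mul1e.
- move=> _ [B mB [C mC <-]].
  rewrite /ok; have [_ /(_ _ _ mC mB)] := hk.
  rewrite (_ : _ @^-1` (B `*` C) = F @^-1` C `&` V @^-1` B); last first.
    by apply/seteqP; split => x /= [].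
  move=> ->; rewrite -integral_indic_comp; apply: eq_integral => w _.
  rewrite indicE; case: (boolP (V w \in B)) => VB.
    by rewrite in_xsectionX// mul1e.
  by rewrite notin_xsectionX// measure0 mul0e.
- move=> S mS IH; rewrite /ok.
  have -> : \int[P]_w k (V w) (xsection (~` S) (V w)) =
      \int[P]_w (1 - k (V w) (xsection S (V w))).
    apply: eq_integral => w _; rewrite -probability_setC; last exact: measurable_xsection.
    by rewrite !xsectionE preimage_setC.
  rewrite preimage_setC probability_setC; last exact: mpre.
  have mxS := mxs mS.
  have le1 w : k (V w) (xsection S (V w)) <= 1.
    by apply: probability_le1; exact: measurable_xsection.
  rewrite integralB//.
  + rewrite integral_cst// mul1e [X in X - _]probability_setT.
    by congr (_ - _).
  + exact: finite_measure_integrable_cst.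
  + apply: (@le_integrable _ _ _ P _ measurableT _ (EFin \o cst 1%R)) => //.
      by move=> w _; rewrite /= normr1 gee0_abs.
    exact: finite_measure_integrable_cst.
- move=> S mS tS IH; rewrite /ok.
  rewrite preimage_bigcup measure_semi_bigcup//; last 3 first.
    by move=> i; exact: mpre.
    by move=> i j _ _ [w [Si Sj]]; apply: tS => //; exists (V w, F w).
    by apply: bigcup_measurable => i _; exact: mpre.
  transitivity (\sum_(0 <= n <oo) \int[P]_w k (V w) (xsection (S n) (V w))); last first.
    by apply: eq_eseriesr => n _; exact: IH.
  rewrite -integral_nneseries//; last by move=> n; exact: mxs.
  apply: eq_integral => w _; rewrite xsection_bigcup measure_semi_bigcup//.
  + by move=> i; exact: measurable_xsection.
  + exact: trivIset_xsection.
  + by apply: bigcup_measurable => i _; exact: measurable_xsection.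
Qed.

(** Monotone class argument, starting from the indicators settled by [cond_law_xsection]. *)
Lemma integral_cond_law (G : TV * TF -> \bar R) :
  measurable_fun setT G -> (forall z, 0 <= G z) ->
  \int[P]_w \int[k (V w)]_x G (V w, x) = \int[P]_w G (V w, F w).
Proof.
have mi (f : TV * TF -> \bar R) : measurable_fun setT f -> (forall z, 0 <= f z) ->
    measurable_fun setT (fun w => \int[k (V w)]_x f (V w, x)).
  by move=> mf f0; exact: (measurableT_comp (measurable_law_integral mk mf f0)).
have ms (f : TV * TF -> \bar R) v : measurable_fun setT f ->
    measurable_fun setT (fun x => f (v, x)).
  by move=> mf; exact: (measurableT_comp mf).
have mc (f : TV * TF -> \bar R) : measurable_fun setT f ->
    measurable_fun setT (fun w => f (V w, F w)).
  by move=> mf; exact: (measurableT_comp mf).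
move: G; apply: ge0_measurable_fun_ind => /=.
- move=> A mA; transitivity (P ((fun w => (V w, F w)) @^-1` A)).
    rewrite -cond_law_xsection//; apply: eq_integral => w _.
    have := kfcompkindic (fun v => k v : {measure set TF -> \bar R}) mA.
    by rewrite /kfcomp => /funeqP/(_ (V w)).
  rewrite (_ : (fun w => _) = EFin \o \1_((fun w => (V w, F w)) @^-1` A))//.
  rewrite integral_indic// ?setIT//.
  by rewrite -[X in measurable X]setTI; exact: mVF.
- move=> c f c0 mf f0 IH.
  under eq_integral.
    move=> w _; rewrite ge0_integralZl//; last exact: ms.
    over.
  by rewrite !ge0_integralZl// ?IH//; [exact: mc|exact: mi|move=> *; exact: integral_ge0].
- move=> f g mf mg f0 g0 IHf IHg.
  under eq_integral.
    move=> w _; rewrite ge0_integralD//; [|exact: ms|exact: ms].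
    over.
  rewrite [LHS]ge0_integralD//; try exact: mi; try by move=> *; exact: integral_ge0.
  by rewrite [RHS]ge0_integralD// ?IHf ?IHg//; exact: mc.
move=> f mf f0 ndf IH.
transitivity (\int[P]_w limn (fun n => \int[k (V w)]_x f n (V w, x))).
  apply: eq_integral => w _.
  apply: (@monotone_convergence _ _ _ _ _ measurableT (fun n x => f n (V w, x))) => //.
  by move=> n; exact: ms.
rewrite (@monotone_convergence _ _ _ P _ measurableT
  (fun n w => \int[k (V w)]_x f n (V w, x))); last 3 first.
- by move=> n; exact: mi.
- by move=> *; exact: integral_ge0.
- move=> w _ m n mn; apply: ge0_le_integral => //; try exact: ms.
  by move=> x _; exact: ndf.
rewrite (@monotone_convergence _ _ _ P _ measurableT (fun n w => f n (V w, F w)))//.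
  by congr (limn _); apply/funext => n; rewrite IH.
by move=> n; exact: mc.
Qed.

End disintegration.

(** * Conditional probabilities: existence, uniqueness, testing on rectangles *)

Section restr_distribution.
Context (R : realType) d dV (T : measurableType d) (TV : measurableType dV)
  (P : probability T R) (E : set T) (mE : measurable E) (V : {mfun T >-> TV}).

(** This measure is dominated by the law of [V], and its density is the conditional probability of
    [E] given [V]. *)
Definition restr_distribution : set TV -> \bar R := pushforward (mrestr P mE) V.

Let restr_distribution0 : restr_distribution set0 = 0.
Proof. exact: measure0. Qed.

Let restr_distribution_ge0 A : 0 <= restr_distribution A.
Proof. exact: measure_ge0. Qed.

Let restr_distribution_sigma_additive : semi_sigma_additive restr_distribution.
Proof. exact: measure_semi_sigma_additive. Qed.

HB.instance Definition _ := isMeasure.Build _ _ _ restr_distribution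
  restr_distribution0 restr_distribution_ge0 restr_distribution_sigma_additive.

Let restr_distribution_fin : fin_num_fun restr_distribution.
Proof.
move=> B mB; apply: (fin_num_measure P); apply: measurableI => //.
by rewrite -[X in measurable X]setTI; exact: (measurable_funP V).
Qed.

HB.instance Definition _ := Measure_isFinite.Build _ _ _ restr_distribution
  restr_distribution_fin.

End restr_distribution.

Section conditional_probability.
Context (R : realType) d (Omega : measurableType d) (P : probability Omega R).

(** Transported to the law of [V], the hypothesis compares [f] and [g] on every measurable set. They
    agree outside a null set [N] of that law, and the preimage of [N] is null under [P]. *)
Lemma ae_eq_comp_integral dV (TV : measurableType dV) (V : Omega -> TV)
    (f g : TV -> \bar R) :
  measurable_fun setT V -> measurable_fun setT f -> measurable_fun setT g ->
  P.-integrable setT (f \o V) -> P.-integrable setT (g \o V) ->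
  (forall B, measurable B ->
    \int[P]_(w in V @^-1` B) f (V w) = \int[P]_(w in V @^-1` B) g (V w)) ->
  {ae P, forall w, f (V w) = g (V w)}.
Proof.
move=> mV mf mg fV gV fg.
have mpre B : measurable B -> measurable (V @^-1` B).
  by move=> mB; rewrite -[X in measurable X]setTI; exact: mV.
pose V' : {mfun Omega >-> TV} := HB.pack V (isMeasurableFun.Build _ _ _ _ V mV).
have [N [mN N0 fgN]] : ae_eq (distribution P V') setT f g.
  apply: integral_ae_eq => //; first exact: integrable_pushforward.
  move=> E _ mE; rewrite !integral_pushforward//; first exact: fg.
    by apply: integrableS gV => //; exact: mpre.
  by apply: integrableS fV => //; exact: mpre.
exists (V @^-1` N); split; [exact: mpre|exact: N0|move=> w /= fgw].
by apply: fgN => /= /(_ I).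
Qed.

Lemma cond_prob_unique dV (TV : measurableType dV) (V : Omega -> TV) E p q :
  measurable_fun setT V -> is_cond_prob P E V p -> is_cond_prob P E V q ->
  {ae P, forall w, p (V w) = q (V w)}.
Proof.
move=> mV [mp ip hp] [mq iq hq].
have : {ae P, forall w, (EFin \o p) (V w) = (EFin \o q) (V w)}.
  apply: ae_eq_comp_integral => //; [exact/measurable_EFinP|exact/measurable_EFinP|].
  by move=> B mB; rewrite -hp// -hq.
by apply: filterS => w [].
Qed.

(** The version is the Radon-Nikodym derivative of [restr_distribution]. Nonnegativity at every
    point, not only almost surely, lets it enter [ge0_integral_weight]. *)
Lemma ge0_cond_prob_exists dV (TV : measurableType dV) (V : Omega -> TV) E :
  measurable_fun setT V -> measurable E ->
  exists2 q, (forall v, 0 <= q v)%R & is_cond_prob P E V q.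
Proof.
move=> mV mE.
have mpre B : measurable B -> measurable (V @^-1` B).
  by move=> mB; rewrite -[X in measurable X]setTI; exact: mV.
pose V' : {mfun Omega >-> TV} := HB.pack V (isMeasurableFun.Build _ _ _ _ V mV).
have [] := @radon_nikodym_sigma_finite _ _ _ (distribution P V')
  (restr_distribution P mE V').
  move=> B BN A mA AB; have P0 : P (V @^-1` A) = 0 by exact: BN.
  apply: (subset_measure0 _ _ _ P0) => //; [|exact: mpre].
  by apply: measurableI => //; exact: mpre.
move=> q [q0 qfin iq qE]; exists (fun v => fine (q v)) => [v|]; first by rewrite fine_ge0.
have mq := measurable_int _ iq.
have mfq : measurable_fun setT (fun v => fine (q v)) by exact: measurableT_comp.
split => //.
  under eq_fun do rewrite fineK//.
  apply/integrableP; split; first exact: (measurableT_comp mq).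
  have /integrableP[_] := iq.
  by rewrite ge0_integral_pushforward//; exact: measurableT_comp.
move=> B mB; under eq_integral do rewrite fineK//.
rewrite -(@ge0_integral_pushforward _ _ _ _ _ _ mV P B q)//;
  last exact: measurable_funS mq.
by rewrite setIC; exact: qE.
Qed.

Lemma cond_law_prob dV dF (TV : measurableType dV) (TF : measurableType dF)
    (V : Omega -> TV) (F : Omega -> TF) k A :
  measurable_fun setT V -> is_cond_law P F V k -> measurable A ->
  is_cond_prob P (F @^-1` A) V (fun v => fine (k v A)).
Proof.
move=> mV [mk hk] mA.
have mkA : measurable_fun setT (fun v => k v A) by exact: measurable_law_eval.
have kfin v : k v A \is a fin_num by exact: fin_num_measure.
have mfk : measurable_fun setT (fun v => fine (k v A)) by exact: measurableT_comp.
split=> //.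
  apply: (@le_integrable _ _ _ P _ measurableT _ (EFin \o cst 1%R)) => //.
  - by apply/measurable_EFinP; exact: (measurableT_comp mfk).
  - by move=> w _; rewrite fineK// /= normr1 gee0_abs// probability_le1.
  - exact: finite_measure_integrable_cst.
by move=> B mB; rewrite hk//; apply: eq_integral => w _; rewrite fineK.
Qed.

(** Dynkin's argument again; integrability makes the subtraction for complements legitimate. *)
Lemma integral_preimage_prod_eq d1 d2 (T1 : measurableType d1)
    (T2 : measurableType d2) (Z1 : Omega -> T1) (Z2 : Omega -> T2)
    (g1 g2 : Omega -> \bar R) :
  measurable_fun setT Z1 -> measurable_fun setT Z2 ->
  (forall w, 0 <= g1 w) -> (forall w, 0 <= g2 w) ->
  P.-integrable setT g1 -> P.-integrable setT g2 ->
  (forall B1 B2, measurable B1 -> measurable B2 ->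
    \int[P]_(w in Z1 @^-1` B1 `&` Z2 @^-1` B2) g1 w =
    \int[P]_(w in Z1 @^-1` B1 `&` Z2 @^-1` B2) g2 w) ->
  forall B, measurable B ->
    \int[P]_(w in rv_pair Z1 Z2 @^-1` B) g1 w =
    \int[P]_(w in rv_pair Z1 Z2 @^-1` B) g2 w.
Proof.
move=> mZ1 mZ2 g10 g20 ig1 ig2 g12 B mB.
have mg1 := measurable_int P ig1.
have mg2 := measurable_int P ig2.
have mZ : measurable_fun setT (rv_pair Z1 Z2) by exact: measurable_fun_pair.
have mpre S : measurable S -> measurable (rv_pair Z1 Z2 @^-1` S).
  by move=> mS; rewrite -[X in measurable X]setTI; exact: mZ.
pose ok B := \int[P]_(w in rv_pair Z1 Z2 @^-1` B) g1 w =
    \int[P]_(w in rv_pair Z1 Z2 @^-1` B) g2 w.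
move: mB; rewrite measurable_prod_measurableType; apply: (@dynkin_induction _ _ _ ok).
- exact: measurable_prod_measurableType.
- move=> _ _ [A1 mA1 [A2 mA2 <-]] [B1 mB1 [B2 mB2 <-]].
  exists (A1 `&` B1); first exact: measurableI.
  by exists (A2 `&` B2); [exact: measurableI|rewrite setXI].
- by have := g12 _ _ measurableT measurableT; rewrite /ok !preimage_setT setIT.
- move=> _ [B1 mB1 [B2 mB2 <-]]; have := g12 _ _ mB1 mB2.
  rewrite /ok (_ : _ @^-1` (B1 `*` B2) = Z1 @^-1` B1 `&` Z2 @^-1` B2)//.
- move=> S mS IH.
  have split_int g : (forall w, 0 <= g w) -> measurable_fun setT g ->
      \int[P]_w g w = \int[P]_(w in rv_pair Z1 Z2 @^-1` S) g w +
        \int[P]_(w in rv_pair Z1 Z2 @^-1` (~` S)) g w.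
    move=> g0 mg; rewrite -ge0_integral_setU//.
    + by rewrite preimage_setC setUv.
    + exact: mpre.
    + by apply: mpre; exact: measurableC.
    + exact: measurable_funS mg.
    + by apply/disj_setPS; rewrite preimage_setC setICr.
  have := g12 _ _ measurableT measurableT; rewrite !preimage_setT setIT.
  rewrite (split_int g1)// (split_int g2)// IH addeC [RHS]addeC.
  move=> /(congr1 (fun x => x - \int[P]_(w in rv_pair Z1 Z2 @^-1` S) g2 w)).
  have If : \int[P]_(w in rv_pair Z1 Z2 @^-1` S) g2 w \is a fin_num.
    apply: integrable_fin_num; first exact: mpre.
    by apply: integrableS ig2 => //; exact: mpre.
  by rewrite !addeK.
- move=> S mS tS IH; rewrite /ok preimage_bigcup.
  have tZ : trivIset setT (fun n => rv_pair Z1 Z2 @^-1` S n).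
    by move=> i j _ _ [w [Si Sj]]; apply: tS => //; exists (rv_pair Z1 Z2 w).
  have mU : measurable (\bigcup_n (rv_pair Z1 Z2 @^-1` S n)).
    by apply: bigcup_measurable => n _; exact: mpre.
  rewrite !ge0_integral_bigcup//; try (by move=> n; exact: mpre).
  + by apply: eq_eseriesr => n _; exact: IH.
  + exact: measurable_funS mg2.
  + exact: measurable_funS mg1.
Qed.

End conditional_probability.

(** * Conditional independence in terms of conditional laws *)

Section conditional_independence.
Context (R : realType) d (Omega : measurableType d) (P : probability Omega R).

Section markov.
Context dF dY dU (TF : measurableType dF) (TY : measurableType dY)
  (TU : measurableType dU) (F : Omega -> TF) (Y : Omega -> TY) (U : Omega -> TU)
  (k : TU -> pprobability TF R).
Hypotheses (mF : measurable_fun setT F) (mY : measurable_fun setT Y)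
  (mU : measurable_fun setT U) (hk : is_cond_law P F U k).

Let mpreF A : measurable A -> measurable (F @^-1` A).
Proof. by move=> mA; rewrite -[X in measurable X]setTI; exact: mF. Qed.

Let mpreY A : measurable A -> measurable (Y @^-1` A).
Proof. by move=> mA; rewrite -[X in measurable X]setTI; exact: mY. Qed.

Let mpreU A : measurable A -> measurable (U @^-1` A).
Proof. by move=> mA; rewrite -[X in measurable X]setTI; exact: mU. Qed.

Let mk : measurable_fun setT k.
Proof. by case: hk. Qed.

(** Since [q] is the conditional probability that [Y] lies in [B1], a weight that depends on [U]
    alone has the same integral against [q] as against the indicator of that event. Both directions
    of the equivalence below rest on this. *)
Let integral_law_cond_prob A B1 B2 (q : TU -> R) :
  measurable A -> measurable B1 -> measurable B2 ->
  (forall u, 0 <= q u)%R -> is_cond_prob P (Y @^-1` B1) U q ->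
  \int[P]_(w in U @^-1` B2) (k (U w) A * (q (U w))%:E) =
  \int[P]_(w in Y @^-1` B1 `&` U @^-1` B2) k (U w) A.
Proof.
move=> mA mB1 mB2 q0 [mq _ hq].
pose phi u := (\1_B2 u)%:E * k u A.
have mphi : measurable_fun setT phi.
  apply: emeasurable_funM; last exact: measurable_law_eval.
  by apply/measurable_EFinP; exact: measurable_indic.
have phi0 u : 0 <= phi u by rewrite mule_ge0// lee_fin.
rewrite -integral_indic_comp; under eq_integral do rewrite muleA.
rewrite (@ge0_integral_weight _ _ _ _ _ _ _ _ (EFin \o \1_(Y @^-1` B1)) phi)//.
- rewrite -[_ `&` _]/((fun w => (Y w, U w)) @^-1` (B1 `*` B2)).
  rewrite -integral_indic_comp; apply: eq_integral => w _.
  rewrite /phi /= muleAC -EFinM; congr (_%:E * _).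
  rewrite !indicE in_setX/= -natrM mulnb andbC; congr (_ && _)%:R.
- by apply/measurable_EFinP; exact: (measurableT_comp mq).
- by apply/measurable_EFinP; apply: measurable_indic; exact: mpreY.
- by move=> w; rewrite lee_fin.
- by move=> w; rewrite /= lee_fin.
- by move=> B mB; rewrite -hq//= integral_indic//; [exact: mpreU|exact: mpreY].
Qed.

(** Knowing [Y] besides [U] leaves the conditional law of [F] unchanged. Test events in [(Y, U)] may
    be taken to be rectangles, and on these the identity is the product rule integrated over an
    event of [U]. *)
Lemma cond_indep_cond_law :
  cond_indep P F Y U -> is_cond_law P F (rv_pair Y U) (k \o snd).
Proof.
move=> FY; split; first exact: measurableT_comp.
move=> A B mA mB.
have mFA := mpreF mA.
have mkA : measurable_fun setT (fun w => k (U w) A).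
  exact: (measurableT_comp (measurable_law_eval mk mA)).
rewrite -[LHS](integral_indic P) //; last first.
  by rewrite -[X in measurable X]setTI; exact: (measurable_fun_pair mY mU).
have ione : P.-integrable setT (EFin \o cst 1%R).
  exact: finite_measure_integrable_cst.
apply: (integral_preimage_prod_eq mY mU) => //.
- apply: (le_integrable measurableT _ _ ione) => //.
    by apply/measurable_EFinP; exact: measurable_indic.
  move=> w _; rewrite /= normr1 lee_fin indicE; case: (_ \in _).
    by rewrite normr1.
  by rewrite normr0.
- apply: (le_integrable measurableT _ _ ione) => // w _.
  by rewrite /= normr1 gee0_abs// probability_le1.
move=> B1 B2 mB1 mB2; rewrite integral_indic//; last first.
  by apply: measurableI; [exact: mpreY|exact: mpreU].
(* The product rule is given for some versions [p] and [q]; uniqueness trades them almost surely for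
   the kernel at [A] and for the nonnegative version [q']. *)
have [p [q [hp hq hpq]]] := FY A B1 mA mB1.
have [q' q'0 hq'] := ge0_cond_prob_exists P mU (mpreY mB1).
have pE := cond_prob_unique mU hp (cond_law_prob mU hk mA).
have qE := cond_prob_unique mU hq hq'.
rewrite -(integral_law_cond_prob mA mB1 mB2 q'0 hq').
have [_ _ hpqE] := hpq.
rewrite setIA; transitivity (P (F @^-1` A `&` Y @^-1` B1 `&` U @^-1` B2)) => //.
rewrite hpqE// integral_mkcond [RHS]integral_mkcond.
apply: integral_ae_congr; move: pE qE; apply: filterS2 => w pE qE.
by rewrite !patchE; case: ifP => // _; rewrite pE qE EFinM fineK// fin_num_measure.
Qed.

(** The kernel at [A] and a nonnegative version [q] serve as the two versions; the law given
    [(Y, U)], tested on a rectangle, yields their product rule. *)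
Lemma cond_law_cond_indep :
  is_cond_law P F (rv_pair Y U) (k \o snd) -> cond_indep P F Y U.
Proof.
move=> [_ hYU] A B1 mA mB1.
have [q q0 hq] := ge0_cond_prob_exists P mU (mpreY mB1).
have hp := cond_law_prob mU hk mA.
exists (fun u => fine (k u A)), q; split => //.
have [mp _ _] := hp; have [mq iq _] := hq.
have mpq : measurable_fun setT (fun v => fine (k v A) * q v)%R by exact: measurable_funM.
split => //.
- apply: (le_integrable measurableT _ _ iq) => //.
    by apply/measurable_EFinP; exact: (measurableT_comp mpq).
  move=> w _; rewrite EFinM abseM -[leRHS]mul1e lee_wpmul2r//.
  by rewrite fineK ?fin_num_measure// gee0_abs// probability_le1.
move=> B2 mB2; rewrite -setIA.
rewrite -[Y @^-1` B1 `&` _]/(rv_pair Y U @^-1` (B1 `*` B2)) hYU//;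
  last exact: measurableX.
rewrite -[RHS](_ : \int[P]_(w in U @^-1` B2) (k (U w) A * (q (U w))%:E) = _).
  by rewrite (integral_law_cond_prob mA mB1 mB2 q0 hq).
by apply: eq_integral => w _; rewrite EFinM fineK// fin_num_measure.
Qed.

End markov.

Section cond_law.
Context dF dZ (TF : measurableType dF) (TZ : measurableType dZ)
  (F : Omega -> TF) (Z : Omega -> TZ).

Lemma cond_law_unique (k k' : TZ -> pprobability TF R) A :
  measurable_fun setT Z -> is_cond_law P F Z k -> is_cond_law P F Z k' ->
  measurable A -> {ae P, forall w, k (Z w) A = k' (Z w) A}.
Proof.
move=> mZ hk hk' mA.
have := cond_prob_unique mZ (cond_law_prob mZ hk mA) (cond_law_prob mZ hk' mA).
apply: filterS => w kk'.
by rewrite -[LHS]fineK ?fin_num_measure// kk' fineK// fin_num_measure.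
Qed.

Lemma cond_law_ae (k k' : TZ -> pprobability TF R) :
  is_cond_law P F Z k -> measurable_fun setT k' ->
  {ae P, forall w, same_law (k (Z w)) (k' (Z w))} -> is_cond_law P F Z k'.
Proof.
move=> [_ hk] mk' kk'; split => // A B mA mB; rewrite hk//.
rewrite integral_mkcond [RHS]integral_mkcond.
apply: integral_ae_congr; move: kk'; apply: filterS => w kk'.
by rewrite !patchE; case: ifP => // _; exact: kk'.
Qed.

(** Each of [Z] and [Z'] is a measurable function of the other, so they generate the same
    sigma-algebra. This serves to reorder the components of a conditioning tuple. *)
Lemma cond_law_transport dZ' (TZ' : measurableType dZ') (Z' : Omega -> TZ')
    (s : TZ -> TZ') (t : TZ' -> TZ) (k : TZ' -> pprobability TF R) :
  measurable_fun setT s -> measurable_fun setT t ->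
  (forall w, s (Z w) = Z' w) -> (forall w, t (Z' w) = Z w) ->
  is_cond_law P F Z' k -> is_cond_law P F Z (k \o s).
Proof.
move=> ms mt sZ tZ' [mk hk]; split; first exact: measurableT_comp.
move=> A B mA mB.
have -> : Z @^-1` B = Z' @^-1` (t @^-1` B).
  by apply/seteqP; split => w /=; rewrite tZ'.
rewrite hk//; first by apply: eq_integral => w _; rewrite /= sZ.
by rewrite -[X in measurable X]setTI; exact: mt.
Qed.

End cond_law.

End conditional_independence.

(** * Countable determining classes and measurable extension of the loss *)

Lemma standard_borel_determining (R : realType) d (T : measurableType d) :
  standard_borel R T -> exists G : (set T)^nat,
    (forall n, measurable (G n)) /\
    forall p q : pprobability T R, (forall n, p (G n) = q (G n)) -> same_law p q.
Proof.
move=> [E [f [_ [B /countable_injP[g ginj] [Bo Bb]] [h fK hK] mf]]].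
(* [b] enumerates the countable base along the injection [g]; an index that [g] does not attain on
   the base gives the whole space, which is open too. *)
pose b n : set E := xget setT [set U | B U /\ g U = n].
have bo n : open (b n).
  by rewrite /b; case: xgetP => [U _ [/Bo]|_]//; exact: openT.
have bg U : B U -> b (g U) = U.
  move=> BU; rewrite /b; case: xgetP => [W _ [BW gW]|/(_ U)]; last by case.
  by apply: ginj; rewrite ?inE.
pose I (s : seq nat) : set T := f @^-1` (\big[setI/setT]_(i <- s) b i).
have Io s : open (\big[setI/setT]_(i <- s) b i).
  elim: s => [|i s IH]; first by rewrite big_nil; exact: openT.
  by rewrite big_cons; exact: openI.
have mI s : measurable (I s) by apply/mf; exact: sub_sigma_algebra.
(* Preimages of finite intersections of base sets form a pi-system that generates the sigma-algebra,
   and it is countable because [seq nat] is. *)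
pose G := range I.
have GI : setI_closed G.
  move=> _ _ [s _ <-] [t _ <-]; exists (s ++ t) => //.
  by rewrite /I big_cat preimage_setI.
have mG : @measurable _ T = <<s G >>.
  apply/seteqP; split; last first.
    apply: smallest_sub; first exact: sigma_algebra_measurable.
    by move=> _ [s _ <-]; exact: mI.
  move=> A mA.
  have AE : A = f @^-1` (h @^-1` A) by apply/seteqP; split => x /=; rewrite fK.
  have : <<s @open E >> (h @^-1` A) by apply/mf; rewrite -AE.
  rewrite [X in _ -> _ X]AE; move: (h @^-1` A) => {AE mA}A.
  apply: (@smallest_sub _ _ _ [set W | <<s G >> (f @^-1` W)]).
    have [G0 GC GU] := smallest_sigma_algebra setT G.
    split => /=.
    - by rewrite preimage_set0.
    - by move=> W GW; rewrite setTD preimage_setC -setTD; exact: GC.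
    - by move=> F GF; rewrite preimage_bigcup; exact: GU.
  move=> U oU /=.
  (* By second countability, [U] is the union of the base sets that it contains; the others are
     replaced by the empty set. *)
  pose F n := if `[< b n `<=` U >] then b n else set0.
  have -> : U = \bigcup_n F n.
    apply/seteqP; split => [x Ux|x [n _]]; last first.
      by rewrite /F; case: ifPn => // /asboolP; exact.
    have [W [BW Wx] WU] : filter_from [set U | B U /\ U x] id U.
      by apply: Bb; exact: open_nbhs_nbhs.
    exists (g W) => //; rewrite /F bg//; case: ifPn => // /asboolP.
    by move=> /(_ WU).
  rewrite preimage_bigcup; apply: sigma_algebra_bigcup => n.
  rewrite /F; case: ifPn => _.
    apply: sub_sigma_algebra; exists [:: n] => //.
    by rewrite /I big_cons big_nil setIT.
  by rewrite preimage_set0; have [] := smallest_sigma_algebra setT G.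
(* Numbers that code no list are sent to the empty list, whose set is the whole space. *)
exists (fun n => I (odflt [::] (unpickle n))); split => // p q pq A mA.
apply: (@measure_unique _ _ _ G (fun=> setT) mG GI _ _ p q) => //.
- by move=> _; exists [::] => //; rewrite /I big_nil preimage_setT.
- by rewrite bigcup_const.
- by move=> _ [s _ <-]; have := pq (pickle s); rewrite pickleK.
- by move=> _; rewrite ltey_eq fin_num_measure.
Qed.

Lemma ereal_lt_ratr (R : realType) (x y : \bar R) : x < y ->
  exists r : rat, x < (ratr r)%:E < y.
Proof.
case: x => [x| |]; case: y => [y| |] //= xy.
- by have [r] := rat_in_itvoo xy; rewrite in_itv/= -!lte_fin => ?; exists r.
- have [|r] := @rat_in_itvoo R x (x + 1); first by rewrite ltrDl.
  by rewrite in_itv/= => /andP[xr _]; exists r; rewrite lte_fin xr ltry.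
- have [|r] := @rat_in_itvoo R (y - 1) y; first by rewrite ltrBlDr ltrDl.
  by rewrite in_itv/= => /andP[_ ry]; exists r; rewrite lte_fin ry ltNyr.
- by exists 0%R; rewrite ltNyr ltry.
Qed.

(** For each rational [e n], the trace hypothesis gives a measurable [A n] that over [Q] is the set
    where [L] is below [e n]. The infimum of the [e n] with [A n z] is measurable on the whole
    product, and over [Q] it is [L] by density of the rationals. *)
Lemma measurable_loss_extension (R : realType) d (T : measurableType d)
    (Q : set (pprobability T R)) (L : pprobability T R -> T -> \bar R) :
  measurable_loss Q L ->
  exists2 L' : pprobability T R * T -> \bar R, measurable_fun setT L' &
    forall p x, Q p -> L p x = L' (p, x).
Proof.
move=> mL.
pose e n : R := ratr (odflt 0%R (unpickle n : option rat)).
have HA n : exists A : set (pprobability T R * T),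
    measurable A /\ forall p x, Q p -> L p x < (e n)%:E <-> A (p, x).
  have [A mA LA] := mL _ (emeasurable_itv `]-oo, (e n)%:E[).
  exists A; split=> // p x Qp.
  have /seteqP[LA1 LA2] := LA.
  split=> [Le|Ap]; first by have [|] := LA1 (p, x) => //; rewrite /= in_itv.
  by have [|_] := LA2 (p, x) => //; rewrite /= in_itv.
have [A hA] := choice HA.
pose S z := [set (e n)%:E | n in [set n | A n z]].
exists (fun z => ereal_inf (S z)).
  apply: (measurability _ (ErealGenInftyO.measurableE R)) => _ /= -[_ [r ->] <-].
  rewrite setTI preimage_itvNyo.
  rewrite (_ : [set z | _] = \bigcup_n (if (e n < r)%R then A n else set0)).
    apply: bigcup_measurable => n _; case: ifPn => // _.
    by have [] := hA n.
  apply/seteqP; split=> z /=.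
    by move=> /ereal_inf_lt[_ [n Anz <-]]; rewrite lte_fin => er; exists n; rewrite ?er.
  move=> [n _]; case: ifPn => // er Anz.
  apply: le_lt_trans (_ : (e n)%:E < _); last by rewrite lte_fin.
  by apply: ereal_inf_lbound; exists n.
move=> p x Qp; apply/eqP; rewrite eq_le; apply/andP; split.
  apply: le_ereal_inf_tmp => _ [n Anz <-].
  by apply: ltW; have [_ /(_ p x Qp)[_]] := hA n; exact.
rewrite leNgt; apply/negP => /ereal_lt_ratr[r /andP[Lr rI]].
have er : e (pickle r) = ratr r by rewrite /e pickleK.
have [_ /(_ p x Qp)[/(_ _)]] := hA (pickle r); rewrite er => /(_ Lr) Ar _.
move: rI; rewrite ltNge => /negP; apply; rewrite -er.
by apply: ereal_inf_lbound; exists (pickle r).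
Qed.

(** * Cancellation in the extended reals *)

Section ereal_cancellation.
Context (R : realType).
Implicit Types x y z t s u : \bar R.

(** With [u = x - y] this is [u^+ - u^- = x - y], rearranged into sums of nonnegative terms, which
    can be integrated term by term. *)
Lemma maxe_sub_cancel x y : 0 <= x -> 0 <= y -> x +? - y ->
  maxe (x - y) 0 + y = maxe (- (x - y)) 0 + x.
Proof.
case: x => [x| |]; case: y => [y| |] // x0 y0 _.
- rewrite -EFinB.
  have [xy|xy] := leP (x - y)%:E 0.
    rewrite max_l; last by rewrite leeNr oppe0.
    by rewrite add0e -EFinN -EFinD; congr _%:E; lra.
  rewrite max_r; last by rewrite leeNl oppe0 ltW.
  by rewrite add0e -EFinD; congr _%:E; lra.
- by rewrite addeNy// maxNye add0e max_l ?leey// addye.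
- rewrite (_ : +oo - y%:E = +oo)//.
  by rewrite maxye (_ : - +oo = -oo)// maxNye add0e.
Qed.

(** Eliminates [s] and [t]. If exactly one of them is infinite, the equations make [x] and [y], or
    [x'] and [y'], infinite, and both sides are [+oo]. *)
Lemma adde_cross x x' y y' s t : 0 <= x -> 0 <= x' -> 0 <= y -> 0 <= y' ->
  0 <= s -> 0 <= t -> s \is a fin_num \/ t \is a fin_num ->
  x + t = x' + s -> y + t = y' + s -> x + y' = x' + y.
Proof.
case: s => [s| |]; case: t => [t| |]; case: x => [x| |]; case: x' => [x'| |];
  case: y => [y| |]; case: y' => [y'| |] //= _ _ _ _ _ _ [|] // _ [] H [] H';
  congr _%:E; lra.
Qed.

Lemma sube_cross x x' y y' : 0 <= x -> 0 <= x' -> 0 <= y -> 0 <= y' ->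
  x +? - x' -> y +? - y' -> x + y' = x' + y -> x - x' = y - y'.
Proof.
case: x => [x| |]; case: x' => [x'| |]; case: y => [y| |]; case: y' => [y'| |];
  rewrite //= => _ _ _ _ _ _ // [] H; congr _%:E; lra.
Qed.

End ereal_cancellation.

(** * Tower property for a difference of nonnegative functions *)

Section tower.
Context (R : realType) d dV (T : measurableType d) (TV : measurableType dV)
  (mu : {finite_measure set T -> \bar R}) (V : T -> TV)
  (a b : T -> \bar R) (al be : TV -> \bar R).
Hypotheses (mV : measurable_fun setT V)
  (ma : measurable_fun setT a) (mb : measurable_fun setT b)
  (mal : measurable_fun setT al) (mbe : measurable_fun setT be)
  (a0 : forall x, 0 <= a x) (b0 : forall x, 0 <= b x)
  (al0 : forall v, 0 <= al v) (be0 : forall v, 0 <= be v).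
Hypothesis a_al : forall B, measurable B ->
  \int[mu]_(x in V @^-1` B) a x = \int[mu]_(x in V @^-1` B) al (V x).
Hypothesis b_be : forall B, measurable B ->
  \int[mu]_(x in V @^-1` B) b x = \int[mu]_(x in V @^-1` B) be (V x).
Hypotheses (ab : {ae mu, forall x, a x +? - b x})
  (albe : {ae mu, forall x, al (V x) +? - be (V x)}).

Let r x := a x - b x.
Let h x := al (V x) - be (V x).

Let mpre B : measurable B -> measurable (V @^-1` B).
Proof. by move=> mB; rewrite -[X in measurable X]setTI; exact: mV. Qed.

Let malV : measurable_fun setT (al \o V). Proof. exact: measurableT_comp. Qed.
Let mbeV : measurable_fun setT (be \o V). Proof. exact: measurableT_comp. Qed.
Let mr : measurable_fun setT r. Proof. exact: emeasurable_funB. Qed.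
Let mh : measurable_fun setT h. Proof. exact: (emeasurable_funB malV mbeV). Qed.
Let mrp : measurable_fun setT r^\+. Proof. exact: measurable_funepos. Qed.
Let mrn : measurable_fun setT r^\-. Proof. exact: measurable_funeneg. Qed.
Let mhp : measurable_fun setT h^\+. Proof. exact: measurable_funepos. Qed.
Let mhn : measurable_fun setT h^\-. Proof. exact: measurable_funeneg. Qed.

Let cancel_int (E : set T) (f g : T -> \bar R) : measurable E ->
  measurable_fun setT f -> measurable_fun setT g ->
  (forall x, 0 <= f x) -> (forall x, 0 <= g x) ->
  {ae mu, forall x, f x +? - g x} ->
  \int[mu]_(x in E) (f \- g)^\+ x + \int[mu]_(x in E) g x =
  \int[mu]_(x in E) (f \- g)^\- x + \int[mu]_(x in E) f x.
Proof.
move=> mE mf mg f0 g0 fg.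
have mfg : measurable_fun setT (f \- g) by exact: emeasurable_funB.
have mp : measurable_fun setT (f \- g)^\+ by exact: measurable_funepos.
have mn : measurable_fun setT (f \- g)^\- by exact: measurable_funeneg.
have mS (k : T -> \bar R) : measurable_fun setT k -> measurable_fun E k.
  exact: measurable_funS.
rewrite -[LHS]ge0_integralD//; [|exact: mS|exact: mS].
rewrite -[RHS]ge0_integralD//; [|exact: mS|exact: mS].
rewrite integral_mkcond [RHS]integral_mkcond; apply: integral_ae_congr.
apply: filterS fg => x fgx; rewrite !patchE; case: ifP => // _.
by rewrite funeposE funenegE maxe_sub_cancel.
Qed.

(** Over [B] one of the integrals of [a] and [b] is finite. As these are also the integrals of [al]
    and [be] along [V], the integrated identities for [r] and [h] share two terms, which
    [adde_cross] removes. *)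
Let cross (B : set TV) (n : nat) : measurable B ->
  (forall v, B v -> al v <= n%:R%:E) \/ (forall v, B v -> be v <= n%:R%:E) ->
  \int[mu]_(x in V @^-1` B) (r^\+ x + h^\- x) =
  \int[mu]_(x in V @^-1` B) (r^\- x + h^\+ x).
Proof.
move=> mB Bn.
have mE := mpre mB.
have mS (k : T -> \bar R) : measurable_fun setT k -> measurable_fun (V @^-1` B) k.
  exact: measurable_funS.
have bounded (f : TV -> \bar R) : measurable_fun setT f -> (forall v, 0 <= f v) ->
    (forall v, B v -> f v <= n%:R%:E) -> \int[mu]_(x in V @^-1` B) f (V x) \is a fin_num.
  move=> mf f0 fn; rewrite ge0_fin_numE; last by apply: integral_ge0 => x _.
  apply: (@le_lt_trans _ _ (\int[mu]_(x in V @^-1` B) (cst n%:R%:E x))).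
    apply: ge0_le_integral => //.
    - by apply: mS; exact: (measurableT_comp mf).
    - by move=> x; exact: fn.
  rewrite integral_cst// lte_mul_pinfty// ?lee_fin//.
  by rewrite ltey_eq fin_num_measure.
rewrite [LHS]ge0_integralD//; [|exact: mS|exact: mS].
rewrite [RHS]ge0_integralD//; [|exact: mS|exact: mS].
apply: (@adde_cross R _ _ _ _ (\int[mu]_(x in V @^-1` B) a x)
  (\int[mu]_(x in V @^-1` B) b x)); try exact: integral_ge0.
- by case: Bn => Bn; [left; rewrite a_al//|right; rewrite b_be//]; exact: bounded.
- exact: (cancel_int mE ma mb).
- by rewrite a_al// b_be//; apply: (cancel_int mE malV mbeV) => /=.
Qed.

(** Written with sums, the equality of the integrals of [r] and [h] makes sense even when both
    halves are infinite. It is added up from [cross] over countably many disjoint events of the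
    sigma-algebra of [V]. *)
Lemma tower_cross :
  \int[mu]_x r^\+ x + \int[mu]_x h^\- x = \int[mu]_x r^\- x + \int[mu]_x h^\+ x.
Proof.
(* Parity interleaves the two families of bounds into one sequence, which by [albe] covers almost
   every [V x]. The witnesses [n.*2.+1] and [n.*2] below have the right parity and, being at least
   [n], are still bounds. *)
pose E n := if odd n then [set v | al v <= n%:R%:E] else [set v | be v <= n%:R%:E].
have mE n : measurable (E n).
  rewrite /E; case: ifP => _.
    rewrite -[X in measurable X]setTI; exact: emeasurable_fun_infty_c.
  rewrite -[X in measurable X]setTI; exact: emeasurable_fun_infty_c.
pose D n := seqDU E n.
have mD n : measurable (D n).
  by apply: measurableD => //; apply: bigsetU_measurable => i _.
have DE n : D n `<=` E n by move=> v [].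
have mpn : measurable_fun setT (r^\+ \+ h^\-) by exact: emeasurable_funD.
have mnp : measurable_fun setT (r^\- \+ h^\+) by exact: emeasurable_funD.
pose W := \bigcup_n (V @^-1` D n).
have mW : measurable W by apply: bigcup_measurable => n _; exact: mpre.
have full (f : T -> \bar R) : measurable_fun setT f -> (forall x, 0 <= f x) ->
    \int[mu]_x f x = \sum_(n <oo) \int[mu]_(x in V @^-1` D n) f x.
  move=> mf f0; rewrite -ge0_integral_bigcup//; last 3 first.
  - by move=> n; exact: mpre.
  - exact: measurable_funS mf.
  - move=> i j _ _ [x [Di Dj]]; apply: (trivIset_seqDU E) => //.
    by exists (V x).
  rewrite [RHS]integral_mkcond; apply: integral_ae_congr.
  apply: filterS albe => x; rewrite patchE => albex.
  suff Wx : W x by rewrite mem_set.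
  rewrite /W -preimage_bigcup /D -seqDU_bigcup_eq.
  have nat_bound (y : \bar R) : 0 <= y -> y != +oo -> exists n, y <= n%:R%:E.
    case: y => [y| |]// y0 _; exists (Num.bound y).
    by rewrite lee_fin ltW// archi_boundP.
  have [aloo|] := eqVneq (al (V x)) +oo; last first.
    move=> /(nat_bound _ (al0 _))[n aln]; exists n.*2.+1 => //=.
    rewrite /E /= odd_double /= (le_trans aln)// lee_fin ler_nat.
    by rewrite -addnn (leq_trans (leq_addr n n)).
  have beoo : be (V x) != +oo.
    by apply: contraTN albex => /eqP ->; rewrite aloo.
  have [n ben] := nat_bound _ (be0 _) beoo; exists n.*2 => //=.
  by rewrite /E odd_double /= (le_trans ben)// lee_fin ler_nat -addnn leq_addr.
transitivity (\int[mu]_x (r^\+ x + h^\- x)); first by rewrite ge0_integralD.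
transitivity (\int[mu]_x (r^\- x + h^\+ x)); last by rewrite ge0_integralD.
rewrite (full (r^\+ \+ h^\-))//; last by move=> x; rewrite adde_ge0.
rewrite (full (r^\- \+ h^\+))//; last by move=> x; rewrite adde_ge0.
apply: eq_eseriesr => n _; apply: (@cross _ n) => //.
have := @DE n; rewrite /E; case: ifP => _ DEn; [left|right] => v; exact: DEn.
Qed.

Lemma tower_integral : integral_defined mu r -> integral_defined mu h ->
  \int[mu]_x r x = \int[mu]_x h x.
Proof.
move=> dr dh; rewrite integralE [RHS]integralE.
by apply: sube_cross => //; [exact: integral_ge0..|exact: tower_cross].
Qed.

End tower.

(** * Expectation of a difference whose first term may lack an expectation *)

Section ereal_difference.
Context (R : realType).
Implicit Types x y : \bar R.

Lemma le_sube_ge0 x y : y <= x -> x +? - y -> 0 <= x - y.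
Proof.
case: x => [x| |]; case: y => [y| |] // yx _; last by rewrite addye// leey.
- by rewrite sube_ge0.
- by rewrite /= addey// leey.
- by rewrite /= addye// leey.
Qed.

(** The identity [x - y = (x^+ - x^-) - (y^+ - y^-)] with every subtracted part moved across. *)
Lemma maxe_sub_balance x y : y <= x -> x +? - y ->
  maxe (x - y) 0 + (maxe y 0 + maxe (- x) 0) = maxe x 0 + maxe (- y) 0.
Proof.
have neqNy (u : \bar R) : maxe u 0 != -oo.
  rewrite gt_eqF//.
  by apply: (@lt_le_trans _ _ 0); [exact: ltNy0|rewrite le_max lexx orbT].
case: x => [x| |]; case: y => [y| |] //.
- rewrite lee_fin -EFinB -!EFinN -!EFin_max -!EFinD => yx _; congr _%:E.
  have [] := leP (x - y)%R 0%R; have [] := leP y 0%R; have [] := leP (- x)%R 0%R;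
  have [] := leP x 0%R; have [] := leP (- y)%R 0%R; lra.
- move=> _ _; rewrite (_ : x%:E - -oo = +oo)// (_ : - -oo = +oo)// maxye maxNye.
  by rewrite add0e addye// addey.
- move=> _ _; rewrite (_ : +oo - y%:E = +oo)// (_ : - +oo = -oo)// maxye maxNye.
  by rewrite adde0 !addye.
- move=> _ _; rewrite (_ : - -oo = +oo)// (_ : - +oo = -oo)//.
  by rewrite maxye maxNye !adde0 addye.
Qed.

Lemma maxe_le_add_sub x y : y <= x -> x +? - y ->
  maxe x 0 <= maxe y 0 + maxe (x - y) 0.
Proof.
case: x => [x| |]; case: y => [y| |] //.
- rewrite lee_fin -EFinB -!EFin_max -!EFinD lee_fin => yx _.
  have [] := leP (x - y)%R 0%R; have [] := leP y 0%R; have [] := leP x 0%R; lra.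
- by move=> _ _; rewrite (_ : x%:E - -oo = +oo)// maxye maxNye add0e leey.
- by move=> _ _; rewrite (_ : +oo - y%:E = +oo)// maxye addey ?leey// -EFin_max.
- by move=> _ _; rewrite maxye maxNye add0e.
Qed.

(* Applied to the integrals of [f - g] (a.e. nonnegative), [f^\+], [f^\-],
   [g^\+], [g^\-], and to a value [c] that the integral of [f] takes when it is
   defined; the balance equation is void when [f = f' = +oo], and there
   [f <= g + d] forces [d = +oo]. *)
Lemma sube_balance (d f f' g g' c : \bar R) :
  0 <= d -> 0 <= f -> 0 <= f' -> 0 <= g -> 0 <= g' ->
  g <= f -> f' <= g' -> f <= g + d -> d + (g + f') = f + g' ->
  g +? - g' -> (f +? - f' -> f - f' = c) -> c +? - (g - g') ->
  d = c - (g - g').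
Proof.
case: d => [d| |]; case: f => [f| |]; case: f' => [f'| |]; case: g => [g| |];
  case: g' => [g'| |] => //; case: c => [c| |];
  rewrite //= => _ _ _ _ _ _ _ _ E _ /(_ isT) C _ //; move: E C;
  rewrite -?EFinB -?EFinD => -[] E [] C; congr _%:E; lra.
Qed.

End ereal_difference.

(** If both halves of [f] have infinite integral, so has [g^\-], and [g] has integral [-oo]; then
    [f^\+ <= g^\+ + (f - g)^\+] makes the left side [+oo], and so is the right side because [c]
    cannot be [-oo]. In the other cases the balance of the halves is solved for the difference. *)
Lemma integral_sub_defined (R : realType) d (T : measurableType d)
    (mu : {measure set T -> \bar R}) (f g : T -> \bar R) (c : \bar R) :
  measurable_fun setT f -> measurable_fun setT g ->
  {ae mu, forall x, g x <= f x} -> {ae mu, forall x, f x +? - g x} ->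
  integral_defined mu g -> (integral_defined mu f -> \int[mu]_x f x = c) ->
  c +? - (\int[mu]_x g x) -> \int[mu]_x (f x - g x) = c - \int[mu]_x g x.
Proof.
move=> mf mg gf fg dg fc.
have mfg : measurable_fun setT (f \- g) by exact: emeasurable_funB.
have mp (h : T -> \bar R) : measurable_fun setT h -> measurable_fun setT h^\+.
  exact: measurable_funepos.
have mn (h : T -> \bar R) : measurable_fun setT h -> measurable_fun setT h^\-.
  exact: measurable_funeneg.
have -> : \int[mu]_x (f x - g x) = \int[mu]_x (f \- g)^\+ x.
  apply: integral_ae_congr; move: gf fg; apply: filterS2 => x gfx fgx.
  by rewrite funeposE max_l// le_sube_ge0.
rewrite integralE; apply: (@sube_balance _ _ (\int[mu]_x f^\+ x) (\int[mu]_x f^\- x)).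
all: try (apply: integral_ge0 => x _ //).
- apply: ge0_integral_ae_le => //; apply: filterS gf => x gfx.
  by rewrite !funeposE ge_max !le_max gfx lexx orbT.
- apply: ge0_integral_ae_le => //; apply: filterS gf => x gfx.
  by rewrite !funenegE ge_max !le_max leeN2 gfx lexx orbT.
- rewrite -ge0_integralD//; [|exact: mp|exact: mp].
  apply: ge0_integral_ae_le => // [x|]; first by rewrite adde_ge0.
  move: gf fg; apply: filterS2 => x gfx fgx.
  by rewrite !funeposE; exact: maxe_le_add_sub.
- rewrite -[in LHS]ge0_integralD//; [|exact: mp|exact: mn].
  rewrite -[RHS]ge0_integralD//; [|exact: mp|exact: mn].
  rewrite -[LHS]ge0_integralD//.
  + apply: integral_ae_congr; move: gf fg; apply: filterS2 => x gfx fgx.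
    by rewrite !funeposE !funenegE; exact: maxe_sub_balance.
  + exact: mp.
  + by move=> x _; rewrite adde_ge0.
  + exact: (emeasurable_funD (mp _ mg) (mn _ mf)).
- exact: dg.
- by move=> df; rewrite -integralE; exact: fc.
Qed.

(** * Risks of conditional laws *)

Section cond_law_tower.
Context (R : realType) d (Omega : measurableType d) (P : probability Omega R)
  dF dV dZ (TF : measurableType dF) (TV : measurableType dV)
  (TZ : measurableType dZ) (F : Omega -> TF) (V : Omega -> TV) (Z : Omega -> TZ)
  (s : TZ -> TV) (k : TZ -> pprobability TF R) (k' : TV -> pprobability TF R).

(** Both sides are the expectation of [g (V, F)] on the event that [V] lies in [B]: disintegrate
    along [Z], of which [V] is the function [s], and along [V] itself. *)
Lemma cond_law_tower (g : TV * TF -> \bar R) (B : set TV) :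
  measurable_fun setT F -> measurable_fun setT V -> measurable_fun setT Z ->
  measurable_fun setT s -> (forall w, s (Z w) = V w) ->
  is_cond_law P F Z k -> is_cond_law P F V k' ->
  measurable_fun setT g -> (forall z, 0 <= g z) -> measurable B ->
  \int[P]_(w in V @^-1` B) \int[k (Z w)]_x g (V w, x) =
  \int[P]_(w in V @^-1` B) \int[k' (V w)]_x g (V w, x).
Proof.
move=> mF mV mZ ms sZ hk hk' mg g0 mB.
have mgV v : measurable_fun setT (fun x => g (v, x)) by exact: (measurableT_comp mg).
pose gB (z : TV * TF) := (\1_B z.1)%:E * g z.
have gB0 z : 0 <= gB z by rewrite mule_ge0// lee_fin.
have mgB : measurable_fun setT gB.
  apply: emeasurable_funM => //; apply/measurable_EFinP.
  by apply: measurableT_comp => //; exact: measurable_indic.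
have pull (m : {measure set TF -> \bar R}) w :
    (\1_B (V w))%:E * \int[m]_x g (V w, x) = \int[m]_x gB (V w, x).
  by rewrite -ge0_integralZl// lee_fin.
rewrite -integral_indic_comp -[RHS]integral_indic_comp.
transitivity (\int[P]_w \int[k (Z w)]_x gB (V w, x)).
  by apply: eq_integral => w _; exact: pull.
transitivity (\int[P]_w \int[k' (V w)]_x gB (V w, x)); last first.
  by apply: eq_integral => w _; exact/esym/pull.
rewrite (integral_cond_law mF mV hk' mgB gB0).
pose gZ (z : TZ * TF) := gB (s z.1, z.2).
have mgZ : measurable_fun setT gZ.
  apply: (measurableT_comp mgB); apply: measurable_fun_pair => //.
  exact: (measurableT_comp ms).
have gZE w x : gZ (Z w, x) = gB (V w, x) by rewrite /gZ -[fst _]/(Z w) -[snd _]/x sZ.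
transitivity (\int[P]_w \int[k (Z w)]_x gZ (Z w, x)).
  by apply: eq_integral => w _; apply: eq_integral => x _; rewrite gZE.
transitivity (\int[P]_w gZ (Z w, F w)).
  by apply: (integral_cond_law mF mZ hk mgZ) => z; exact: gB0.
by apply: eq_integral => w _; exact: gZE.
Qed.

End cond_law_tower.

Section risk_of_conditional_laws.
Context (R : realType) d (Omega : measurableType d) (P : probability Omega R)
  dF dV dZ (TF : measurableType dF) (TV : measurableType dV)
  (TZ : measurableType dZ) (F : Omega -> TF) (V : Omega -> TV) (Z : Omega -> TZ)
  (k : TZ -> pprobability TF R) (k' : TV -> pprobability TF R)
  (Q : set (pprobability TF R)) (L : pprobability TF R -> TF -> \bar R).
Hypotheses (mV : measurable_fun setT V) (mZ : measurable_fun setT Z)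
  (mk : measurable_fun setT k) (mk' : measurable_fun setT k')
  (mL : measurable_loss Q L) (QV : {ae P, forall w, Q (k' (V w))}).

(** [G (v, x)] is the loss of the report [k' v] at the outcome [x], computed with the measurable
    extension of [L]. Its halves are nonnegative and measurable, so kernels can integrate them
    separately. *)
Lemma risk_posneg : exists G : TV * TF -> \bar R, measurable_fun setT G /\
  forall p v, Q (k' v) ->
    risk L p (k' v) = \int[p]_x G^\+ (v, x) - \int[p]_x G^\- (v, x) /\
    (risk_defined L p (k' v) ->
      (\int[p]_x G^\+ (v, x)) +? - (\int[p]_x G^\- (v, x))).
Proof.
have [L' mL' LE] := measurable_loss_extension mL.
exists (fun z => L' (k' z.1, z.2)); split.
  apply: (measurableT_comp mL'); apply: measurable_fun_pair => //.
  exact: (measurableT_comp mk').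
move=> p v Qv; pose g x := L' (k' v, x).
have Lg : L (k' v) = g by apply/funext => x; exact: LE.
have gp : (fun x => (fun z => L' (k' z.1, z.2))^\+ (v, x)) = g^\+.
  by apply/funext => x; rewrite !funeposE.
have gn : (fun x => (fun z => L' (k' z.1, z.2))^\- (v, x)) = g^\-.
  by apply/funext => x; rewrite !funenegE.
by rewrite gp gn /risk /risk_defined Lg integralE.
Qed.

(** The extension of [L] gives the risk wherever the report lies in [Q], hence almost surely.
    Outside that event the risk is arbitrary, so measurability is claimed for [rho] alone. *)
Lemma ae_measurable_risk : exists2 rho : Omega -> \bar R,
  measurable_fun setT rho &
  {ae P, forall w, risk L (k (Z w)) (k' (V w)) = rho w}.
Proof.
have [G [mG GE]] := risk_posneg.
have mpart (g : TV * TF -> \bar R) : measurable_fun setT g -> (forall z, 0 <= g z) ->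
    measurable_fun setT (fun w => \int[k (Z w)]_x g (V w, x)).
  (* No map from [Z] to [V] is given here, so the kernel is indexed by the pair [(Z, V)]. *)
  move=> mg g0; pose g2 (z : (TZ * TV) * TF) := g (z.1.2, z.2).
  have mg2 : measurable_fun setT g2.
    apply: (measurableT_comp mg); apply: measurable_fun_pair => //.
    exact: measurableT_comp.
  have mk2 : measurable_fun setT (k \o fst : TZ * TV -> _) by exact: measurableT_comp.
  have m2 := measurable_law_integral mk2 mg2 (fun z => g0 _).
  exact: (measurableT_comp m2 (measurable_fun_pair mZ mV)).
exists (fun w => \int[k (Z w)]_x G^\+ (V w, x) - \int[k (Z w)]_x G^\- (V w, x)).
  by apply: emeasurable_funB; apply: mpart => //;
    [exact: measurable_funepos|exact: measurable_funeneg].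
by apply: filterS QV => w Qw; have [] := GE (k (Z w)) (V w) Qw.
Qed.

(** By [cond_law_tower], [al] and [be] along [V] are the conditional expectations given [V] of [a]
    and [b], the halves of the risk under the finer law; [tower_integral] concludes. *)
Lemma risk_tower (s : TZ -> TV) :
  measurable_fun setT F -> measurable_fun setT s -> (forall w, s (Z w) = V w) ->
  is_cond_law P F Z k -> is_cond_law P F V k' ->
  {ae P, forall w, risk_defined L (k (Z w)) (k' (V w))} ->
  {ae P, forall w, risk_defined L (k' (V w)) (k' (V w))} ->
  integral_defined P (fun w => risk L (k (Z w)) (k' (V w))) ->
  integral_defined P (fun w => bayes_risk L (k' (V w))) ->
  \int[P]_w risk L (k (Z w)) (k' (V w)) = \int[P]_w bayes_risk L (k' (V w)).
Proof.
move=> mF ms sZ hk hk' dr dh.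
have [G [mG GE]] := risk_posneg.
have mGp : measurable_fun setT G^\+ by exact: measurable_funepos.
have mGn : measurable_fun setT G^\- by exact: measurable_funeneg.
pose a w := \int[k (Z w)]_x G^\+ (V w, x).
pose b w := \int[k (Z w)]_x G^\- (V w, x).
pose al v := \int[k' v]_x G^\+ (v, x).
pose be v := \int[k' v]_x G^\- (v, x).
have rE : {ae P, forall w, risk L (k (Z w)) (k' (V w)) = a w - b w}.
  by apply: filterS QV => w Qw; have [] := GE (k (Z w)) (V w) Qw.
have hE : {ae P, forall w, bayes_risk L (k' (V w)) = al (V w) - be (V w)}.
  by apply: filterS QV => w Qw; have [] := GE (k' (V w)) (V w) Qw.
have ab : {ae P, forall w, a w +? - b w}.
  by move: QV dr; apply: filterS2 => w Qw; have [] := GE (k (Z w)) (V w) Qw.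
have albe : {ae P, forall w, al (V w) +? - be (V w)}.
  by move: QV dh; apply: filterS2 => w Qw; have [] := GE (k' (V w)) (V w) Qw.
have mpart (g : TV * TF -> \bar R) : measurable_fun setT g -> (forall z, 0 <= g z) ->
    measurable_fun setT (fun w => \int[k (Z w)]_x g (V w, x)).
  move=> mg g0; pose g2 (z : TZ * TF) := g (s z.1, z.2).
  have mg2 : measurable_fun setT g2.
    apply: (measurableT_comp mg); apply: measurable_fun_pair => //.
    exact: (measurableT_comp ms).
  have m2 := measurable_law_integral mk mg2 (fun z => g0 _).
  rewrite (_ : (fun w => _) = (fun z => \int[k z]_x g2 (z, x)) \o Z).
    exact: (measurableT_comp m2).
  by apply/funext => w /=; apply: eq_integral => x _; rewrite /g2 /= sZ.
move=> /(integral_defined_ae rE) dr' /(integral_defined_ae hE) dh'.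
rewrite (integral_ae_congr rE) (integral_ae_congr hE).
apply: (tower_integral mV) => //.
- exact: mpart.
- exact: mpart.
- exact: measurable_law_integral.
- exact: measurable_law_integral.
- by move=> w; exact: integral_ge0.
- by move=> w; exact: integral_ge0.
- by move=> w; exact: integral_ge0.
- by move=> w; exact: integral_ge0.
- by move=> B mB; exact: (cond_law_tower mF mV mZ ms sZ).
- by move=> B mB; exact: (cond_law_tower mF mV mZ ms sZ).
Qed.

End risk_of_conditional_laws.

(** * Expected divergence and the equality case *)

Lemma ge0_integral_eq0_ae (R : realType) d (T : measurableType d)
    (mu : {measure set T -> \bar R}) (f g : T -> \bar R) :
  measurable_fun setT g -> {ae mu, forall x, f x = g x} ->
  {ae mu, forall x, 0 <= f x} ->
  0 <= \int[mu]_x f x /\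
  (\int[mu]_x f x = 0 <-> {ae mu, forall x, f x = 0}).
Proof.
move=> mg fg f0.
have mgp : measurable_fun setT g^\+ by exact: measurable_funepos.
have fgp : {ae mu, forall x, f x = g^\+ x}.
  by move: fg f0; apply: filterS2 => x fgx fx0; rewrite funeposE max_l -fgx.
rewrite (integral_ae_congr fgp); split; first exact: integral_ge0.
have := ae_eq_integral_abs mu measurableT mgp.
rewrite (eq_integral g^\+); last by move=> x _; rewrite gee0_abs.
move=> ->; split => h.
  by move: h fgp; apply: filterS2 => x /(_ I) gx0 ->.
by move: h fgp; apply: filterS2 => x fx0 fgx _; rewrite -fgx.
Qed.

Theorem theorem2
  (R : realType)
  (d dC dX dF dY : measure_display)
  (Omega : measurableType d) (P : probability Omega R)
  (TC : measurableType dC) (TX : measurableType dX)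
  (TF : measurableType dF) (TY : measurableType dY)
  (bC : standard_borel R TC) (bX : standard_borel R TX)
  (bF : standard_borel R TF) (bY : standard_borel R TY)
  (C : {RV P >-> TC}) (X : {RV P >-> TX}) (F : {RV P >-> TF}) (Y : {RV P >-> TY})
  (markov : cond_indep P F Y (rv_pair X C))
  (kX : TX * TC -> pprobability TF R) (hkX : is_cond_law P F (rv_pair X C) kX)
  (kY : TY * TC -> pprobability TF R) (hkY : is_cond_law P F (rv_pair Y C) kY)
  (SX SY : Omega -> pprobability TF R)
  (SXE : SX = kX \o rv_pair X C) (SYE : SY = kY \o rv_pair Y C)
  (Q : set (pprobability TF R)) (L : pprobability TF R -> TF -> \bar R)
  (mL : measurable_loss Q L) (pL : proper L Q)
  (QSX : {ae P, forall w, Q (SX w)}) (QSY : {ae P, forall w, Q (SY w)})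
  (defD : expected_divergence_defined L P SX SY)
  (defHX : cond_bayes_risk_defined L P SX)
  (defHY : cond_bayes_risk_defined L P SY)
  (defH : cond_bayes_risk L P SY +? - cond_bayes_risk L P SX) :
  [/\ expected_divergence L P SX SY
        = cond_bayes_risk L P SY - cond_bayes_risk L P SX,
      0 <= cond_bayes_risk L P SY - cond_bayes_risk L P SX &
      strictly_proper L Q ->
        (expected_divergence L P SX SY = 0
           <-> {ae P, forall w, same_law (SX w) (SY w)}) /\
        (expected_divergence L P SX SY = 0
           <-> cond_indep P F X (rv_pair Y C))].

Proof.
move: SXE SYE => SXE SYE; subst SX SY.
have mF : measurable_fun setT F by exact: measurable_funPT.
have mX : measurable_fun setT X by exact: measurable_funPT.
have mY : measurable_fun setT Y by exact: measurable_funPT.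
have mC : measurable_fun setT C by exact: measurable_funPT.
have mU : measurable_fun setT (rv_pair X C) by exact: measurable_fun_pair.
have mV : measurable_fun setT (rv_pair Y C) by exact: measurable_fun_pair.
have mZ : measurable_fun setT (rv_pair Y (rv_pair X C)) by exact: measurable_fun_pair.
have [mkX _] := hkX; have [mkY _] := hkY.
(* [S_X] is thus the conditional law of [F] given [(Y, (X, C))], of which [(Y, C)] is a function. *)
have hZ := cond_indep_cond_law mF mY mU hkX markov.
have [mk _] := hZ.
pose hX w := risk L (kX (rv_pair X C w)) (kX (rv_pair X C w)).
pose rXY w := risk L (kX (rv_pair X C w)) (kY (rv_pair Y C w)).
have [rdD _] := defD; have [rdX idX] := defHX; have [rdY idY] := defHY.
have rdXY : {ae P, forall w, risk_defined L (kX (rv_pair X C w)) (kY (rv_pair Y C w))}.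
  by apply: filterS rdD => w [].
have hr : {ae P, forall w, hX w <= rXY w}.
  by move: rdD QSX QSY; apply: filterS3 => w [? ? _] ? ?; exact: pL.
have rh : {ae P, forall w, rXY w +? - hX w} by apply: filterS rdD => w [].
have [rho mrho rhoE] := ae_measurable_risk mV mZ mk mkY mL QSY.
have [eta meta etaE] := ae_measurable_risk mU mU mkX mkX mL QSX.
have DE : {ae P, forall w, rXY w - hX w = (rho \- eta) w}.
  by move: rhoE etaE; apply: filterS2 => w rhow etaw; rewrite /= -rhow -etaw.
have mrhoeta : measurable_fun setT (rho \- eta) by exact: emeasurable_funB.
have D0 : {ae P, forall w, 0 <= rXY w - hX w}.
  by move: hr rh; apply: filterS2 => w; exact: le_sube_ge0.
have [ED_ge0 ED_eq0] := ge0_integral_eq0_ae mrhoeta DE D0.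
have EDE : expected_divergence L P (kX \o rv_pair X C) (kY \o rv_pair Y C) =
    cond_bayes_risk L P (kY \o rv_pair Y C) - cond_bayes_risk L P (kX \o rv_pair X C).
  have hXE : cond_bayes_risk L P (kX \o rv_pair X C) = \int[P]_w eta w.
    exact: integral_ae_congr.
  (* The first term [rho] is R_L(S_X, S_Y), whose expectation may fail to exist; when it exists, the
     tower property identifies it with E H_L(S_Y). *)
  rewrite [LHS](integral_ae_congr DE) hXE; apply: integral_sub_defined => //.
  - by move: hr rhoE etaE; apply: filterS3 => w hrw <- <-.
  - by move: rh rhoE etaE; apply: filterS3 => w hrw <- <-.
  - exact: (integral_defined_ae etaE).
  - move=> drho; rewrite -(integral_ae_congr rhoE).
    have s_meas : measurable_fun setT (fun z : TY * (TX * TC) => (z.1, z.2.2)).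
      by apply: measurable_fun_pair => //; exact: measurableT_comp.
    apply: (risk_tower mV mZ mk mkY mL QSY mF s_meas) => //.
    by apply: integral_defined_ae drho; apply: filterS rhoE => w.
  - by rewrite -hXE.
split=> // [|[_ sL]]; first by rewrite -EDE.
have ED_law : expected_divergence L P (kX \o rv_pair X C) (kY \o rv_pair Y C) = 0 <->
    {ae P, forall w, same_law (kX (rv_pair X C w)) (kY (rv_pair Y C w))}.
  apply: (iff_trans ED_eq0); split => H.
    have rh_eq : {ae P, forall w, hX w = rXY w}.
      move: H rh; apply: filterS2 => w; rewrite /= -/(rXY w) -/(hX w).
      by case: (rXY w) => [x| |]; case: (hX w) => [y| |] // [] /subr0_eq ->.
    have slaw : {ae P, forall w, hX w = rXY w ->
        same_law (kY (rv_pair Y C w)) (kX (rv_pair X C w))}.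
      by move: rdD QSX QSY; apply: filterS3 => w [? ? _] ? ? ?; exact: sL.
    by move: rh_eq slaw; apply: filterS2 => w + S A mA => /S ->.
  (* Equal laws need not be Leibniz equal, so [L] may differ at the reports S_X and S_Y. Integrals
     under the two laws coincide, however, so properness at S_Y gives the reverse inequality
     R_L(S_X, S_Y) <= H_L(S_X). *)
  have le : {ae P, forall w, same_law (kX (rv_pair X C w)) (kY (rv_pair Y C w)) ->
      risk_defined L (kY (rv_pair Y C w)) (kY (rv_pair Y C w)) -> rXY w <= hX w}.
    move: rdD QSX QSY; apply: filterS3 => w [_ rdw _] QXw QYw XY rdYw.
    have intE f : \int[kX (rv_pair X C w)]_x f x = \int[kY (rv_pair Y C w)]_x f x.
      by apply: eq_measure_integral => A mA _; exact: XY.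
    rewrite /rXY /hX /risk !intE; apply: pL => //.
    by move: rdw; rewrite /risk_defined /integral_defined !intE.
  have {}le : {ae P, forall w, rXY w <= hX w}.
    by move: le H rdY; apply: filterS3 => w; exact.
  move: le hr rh; apply: filterS3 => w rle hle.
  have -> : rXY w = hX w by apply/eqP; rewrite eq_le rle.
  by case: (hX w) => [x| |] // _; exact: subee.
(* [s] takes [(X, (Y, C))] to [(Y, (X, C))] and [t] goes back, so S_X is also the conditional law
   given [(X, (Y, C))], the order in which independence of [F] and [X] is tested. *)
pose s (z : TX * (TY * TC)) := (z.2.1, (z.1, z.2.2)).
pose t (z : TY * (TX * TC)) := (z.2.1, (z.1, z.2.2)).
have ms : measurable_fun setT s.
  by do ?apply: measurable_fun_pair => //; exact: measurableT_comp.
have mt : measurable_fun setT t.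
  by do ?apply: measurable_fun_pair => //; exact: measurableT_comp.
have mZ' : measurable_fun setT (rv_pair X (rv_pair Y C)) by exact: measurable_fun_pair.
have hZ' : is_cond_law P F (rv_pair X (rv_pair Y C)) ((kX \o snd) \o s).
  exact: (cond_law_transport ms mt _ _ hZ).
split=> //; apply: (iff_trans ED_law); split => H.
  apply: (cond_law_cond_indep mX mV hkY).
  by apply: (cond_law_ae hZ'); [exact: measurableT_comp|exact: H].
(* Independence makes S_Y, like S_X, a conditional law given [(X, (Y, C))]. Uniqueness leaves one
   null set for each measurable set; the determining class reduces these to countably many. *)
have hZY := cond_indep_cond_law mF mX mV hkY H.
have [G [mG Glaw]] := standard_borel_determining bF.
have : {ae P, forall w, forall n,
    kX (rv_pair X C w) (G n) = kY (rv_pair Y C w) (G n)}.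
  by apply: ae_foralln => n; exact: (cond_law_unique mZ' hZ' hZY (mG n)).
by apply: filterS => w; exact: Glaw.
Qed.
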